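(* Let $n\in\mathbb N^+\cup\{\infty\}$ and let $\xi\in(0,\infty)\setminus\{\sqrt{2k}:k\in\mathbb N^+\}$. For a complex sequence $a=(a_k)_{k=0}^n$ (with $\|a\|_{\mathcal V_n}<\infty$ if $n=\infty$), interpreted as $a_k=\hat v_k(\xi)$, define the data $\tilde S_s=\tilde S_s(\xi)$, $0\le s\le n$, by $$\tilde S_0=\tfrac{\sqrt2}{2}\,\xi\,\hat S^{\mathrm{lin}}_{(1,+1),(1,-1)}(E_0(\xi)),$$ $$\tilde S_s=\sqrt{1+\tfrac{\xi^2}{2s}}\;\hat S^{\mathrm{lin}}_{(s,+1),(0,-1)}(E_s(\xi))\ \text{ if } 0<s<\tfrac{\xi^2}{2},\qquad \tilde S_s=\sqrt{1+\tfrac{\xi^2}{2s}}\;\hat S^{\mathrm{lin}}_{(s,-1),(0,-1)}(E_s(\xi))\ \text{ if } s>\tfrac{\xi^2}{2},$$ where $E_0(\xi)=\sqrt{\xi^2/4+2}$, $E_s(\xi)=\sqrt{\xi^2/4+s+s^2/\xi^2}$ for $s\in\mathbb N^+$, and the linearized scattering coefficients $\hat S^{\mathrm{lin}}$ of the scalar potential are computed with $\hat v_k(\xi_{m}(E)-\xi_p(E))$ replaced by $a_k$ (at these energies $\xi_m(E)-\xi_p(E)=\xi$). Then the linear map $\mathcal L^{\mathrm{lin}}(\xi):(a_k)_{k=0}^n\mapsto(\tilde S_s)_{s=0}^n$ is injective (hence a linear bijection of $\mathbb C^{n+1}$ when $n$ is finite), and there exist constants $C_1,C_2>0$ independent of $\xi$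 and $n$ such that $$C_1\|a\|_{\mathcal V_n}\le\|\tilde S\|_{\mathcal S_n}\le C_2\|a\|_{\mathcal V_n}.$$
   Context: Hermite functions: $\varphi_n(y)=(2^n n!\sqrt\pi)^{-1/2}H_n(y)e^{-y^2/2}$ ($H_n$ the physicists' Hermite polynomials), an orthonormal basis of $L^2(\mathbb R)$; rescaled Hermite functions $\tilde\varphi_k(y)=2^{1/2}\pi^{1/4}\varphi_k(\sqrt2 y)$. Mode indices: $M=\{(n,\pm1):n\in\mathbb N^+\}\cup\{(0,-1)\}$; write $n\pm$ for $(n,\pm1)$. For $E\in\mathbb R$, $M(E)=\{(n,\epsilon)\in M: E^2>2n\}$. For $m=(n,\epsilon_m)\in M(E)$ with $n\ge1$: $\xi_m(E)=\epsilon_m\sqrt{E^2-2n}$ and $\phi_m(y;E)=c_m\big(\sqrt{2n}\,\varphi_{n-1}(y),\,(E-\xi_m(E))\varphi_n(y)\big)^T$ with $c_m=(2n+|E-\xi_m(E)|^2)^{-1/2}$; for $m=(0,-1)$: $\xi_m(E)=-E$, $\phi_m=(0,\varphi_0)^T$. Linearized scattering coefficients: for a bounded, compactly supported, Hermitian-matrix-valued $V(x,y)$, $E\in\mathbb R$ and $m=(n,\epsilon_m),p=(q,\epsilon_p)\in M(E)$, $$\hat S^{\mathrm{lin}}_{m,p}(E;V)=\frac{iE}{\sqrt{E^2-2q}}\iint e^{-i(\xi_m(E)-\xi_p(E))x}\,\overline{\phi_m(y;E)}^T V(x,y)\phi_p(y;E)\,dy\,dx.$$ Scalar potentials: $V(x,y)=\sum_{k=0}^n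 v_k(x)\tilde\varphi_k(y)I_2$ with $v_k$ real-valued, integrable and compactly supported, $\hat v_k(\xi)=\int v_k(x)e^{-i\xi x}dx$; then $\hat S^{\mathrm{lin}}_{m,p}(E)=\frac{iE}{\sqrt{E^2-2q}}\sum_k\hat v_k(\xi_m(E)-\xi_p(E))\int\overline{\phi_m(y;E)}^T\phi_p(y;E)\tilde\varphi_k(y)\,dy$. Norms: for $a=(a_s)_{s=0}^n$, $\|a\|_{\mathcal V_n}=\sum_{s=0}^n|a_s|/\sqrt{s!}$ and $\|a\|_{\mathcal S_n}=\sum_{s=0}^n 2^{s/2}|a_s|/\sqrt{s!}$. *)

(* Defs.v *)
From Stdlib Require Import Reals Lra Factorial.
From Coquelicot Require Import Coquelicot.
Open Scope R_scope.

(* (H_n(y), H_{n+1}(y)) for the physicists' Hermite polynomials: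
   H_0 = 1, H_1 = 2y, H_{n+2} = 2y H_{n+1} - 2(n+1) H_n. *)
Fixpoint hermite_pair (n : nat) (y : R) : R * R :=
  match n with
  | O => (1, 2 * y)
  | S n' => let (a, b) := hermite_pair n' y in
            (b, 2 * y * b - 2 * INR (S n') * a)
  end.

Definition hermiteH (n : nat) (y : R) : R := fst (hermite_pair n y).

Definition hermite_fun (n : nat) (y : R) : R :=
  / sqrt (2 ^ n * INR (Factorial.fact n) * sqrt PI) * hermiteH n y * exp (- y ^ 2 / 2).

Definition hermite_fun_resc (k : nat) (y : R) : R :=
  sqrt 2 * sqrt (sqrt PI) * hermite_fun k (sqrt 2 * y).

(* a mode m = (n, eps); mplus = true means eps = +1, false means eps = -1.
   The valid modes are (n, +-1) with n >= 1 and (0, -1). *)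
Record mode := Mode { midx : nat; mplus : bool }.

Definition msign (m : mode) : R := if mplus m then 1 else -1.

Definition xi_mode (m : mode) (E : R) : R :=
  match midx m with
  | O => - E
  | S _ => msign m * sqrt (E ^ 2 - 2 * INR (midx m))
  end.

Definition c_mode (m : mode) (E : R) : R :=
  / sqrt (2 * INR (midx m) + Rabs (E - xi_mode m E) ^ 2).

(* the two (real) components of phi_m(y;E) (E real, m in M(E)) *)
Definition phi_mode1 (m : mode) (E y : R) : R :=
  match midx m with
  | O => 0
  | S n' => c_mode m E * sqrt (2 * INR (midx m)) * hermite_fun n' y
  end.

Definition phi_mode2 (m : mode) (E y : R) : R :=
  match midx m with
  | O => hermite_fun 0 y
  | S _ => c_mode m E * (E - xi_mode m E) * hermite_fun (midx m) y
  end.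

Inductive ext_nat := Fin (n : nat) | Inf.

Definition le_ext (s : nat) (N : ext_nat) : bool :=
  match N with Fin n => Nat.leb s n | Inf => true end.

Definition CSeries (f : nat -> C) : C :=
  (Series (fun k => Re (f k)), Series (fun k => Im (f k))).

(* y-integral  int conj(phi_m(y;E))^T phi_p(y;E) tilde phi_k(y) dy
   (all functions are real-valued for real E and m,p in M(E)) *)
Definition mode_overlap (m p : mode) (E : R) (k : nat) : R :=
  RInt_gen (fun y => (phi_mode1 m E y * phi_mode1 p E y
                      + phi_mode2 m E y * phi_mode2 p E y) * hermite_fun_resc k y)
           (Rbar_locally m_infty) (Rbar_locally p_infty).

(* linearized scattering coefficient S^lin_{m,p}(E) of the scalar potential
   V = sum_{k=0}^N v_k(x) tilde phi_k(y) I_2, with hat v_k(xi_m(E)-xi_p(E))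
   replaced by a_k *)
Definition Slin (N : ext_nat) (a : nat -> C) (E : R) (m p : mode) : C :=
  (Ci * RtoC (E / sqrt (E ^ 2 - 2 * INR (midx p))) *
   CSeries (fun k => if le_ext k N
                     then (a k * RtoC (mode_overlap m p E k))%C
                     else RtoC 0))%C.

Definition E0 (xi : R) : R := sqrt (xi ^ 2 / 4 + 2).
Definition Es (xi : R) (s : nat) : R :=
  sqrt (xi ^ 2 / 4 + INR s + INR s ^ 2 / xi ^ 2).

Definition Stilde (N : ext_nat) (xi : R) (a : nat -> C) (s : nat) : C :=
  match s with
  | O => (RtoC (sqrt 2 / 2 * xi) *
          Slin N a (E0 xi) (Mode 1 true) (Mode 1 false))%C
  | S _ =>
      if Rlt_dec (INR s) (xi ^ 2 / 2)
      then (RtoC (sqrt (1 + xi ^ 2 / (2 * INR s))) *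
            Slin N a (Es xi s) (Mode s true) (Mode 0 false))%C
      else (RtoC (sqrt (1 + xi ^ 2 / (2 * INR s))) *
            Slin N a (Es xi s) (Mode s false) (Mode 0 false))%C
  end.

Definition V_term (N : ext_nat) (a : nat -> C) (s : nat) : R :=
  if le_ext s N then Cmod (a s) / sqrt (INR (Factorial.fact s)) else 0.

Definition S_term (N : ext_nat) (a : nat -> C) (s : nat) : R :=
  if le_ext s N then sqrt (2 ^ s) * Cmod (a s) / sqrt (INR (Factorial.fact s)) else 0.

Definition normV (N : ext_nat) (a : nat -> C) : R := Series (V_term N a).
Definition normS (N : ext_nat) (a : nat -> C) : R := Series (S_term N a).

Definition admissible_xi (xi : R) : Prop :=
  0 < xi /\ forall k : nat, (1 <= k)%nat -> xi <> sqrt (2 * INR k).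

Definition valid_ext (N : ext_nat) : Prop :=
  match N with Fin n => (1 <= n)%nat | Inf => True end.

(* Main.v *)
Require Import Defs.
From Stdlib Require Import Reals Lra Lia Factorial.
From Coquelicot Require Import Coquelicot.
Open Scope R_scope.

(** At the energy [E_s] one has [E = xi/2 + s/xi] and [xi_m = xi/2 - s/xi], and the prefactor
    [sqrt (1 + xi^2/(2s))] cancels the normalisation of the mode, so that for [s >= 1]
    [S_s = i * sum_k a_k I(s,k)] with [I(s,k)] the integral of [phi_s phi_0 tilde phi_k],
    independent of [xi]. Expanding [H_s (z / sqrt 2)] in Hermite polynomials,
    [I(s,k) = sqrt (s! / (2^s k!)) g(s-k)], where [g] are the Taylor coefficients of
    [exp (- z^2/2)]. With [u_k = a_k / sqrt k!] and [v_s = 2^(s/2) S_s / sqrt s!] the map is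
    thus convolution with [i g], and [g] has l^1 distance at most [2/3] to the identity. Row [0]
    is [v_0 = i (3/2 u_0 + u_2)] instead; since [v_0 - v_2 = 2 i u_0] it determines [u_0] (and for
    [n = 1] the term [u_2] is absent).
    The norm estimate follows, with [C1 = 1/6] and [C2 = 4], and it implies injectivity. *)

(** * Hermite polynomials against the Gaussian *)

Lemma hermite_pairE (n : nat) (y : R) : hermite_pair n y = (hermiteH n y, hermiteH (S n) y).
Proof.
  unfold hermiteH; simpl; destruct (hermite_pair n y) as [a b]; reflexivity.
Qed.

Lemma hermiteH_rec (n : nat) (y : R) :
  hermiteH (S n) y = 2 * y * hermiteH n y - 2 * INR n * hermiteH (pred n) y.
Proof.
  destruct n as [|n]; [unfold hermiteH; simpl; ring|].
  unfold hermiteH at 1; cbn [hermite_pair].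
  rewrite hermite_pairE; reflexivity.
Qed.

(** Two-step induction fits the recursions of [hermiteH], [gauss_coef] and [geom_coef], which all
    reach back two indices. *)
Lemma nat_pair_ind (P : nat -> Prop) :
  P 0%nat -> P 1%nat -> (forall n, P n -> P (S n) -> P (S (S n))) -> forall n, P n.
Proof.
  intros H0 H1 H n; enough (P n /\ P (S n)) by tauto.
  induction n as [|n [IH1 IH2]]; split; auto.
Qed.

Lemma is_derive_hermiteH (n : nat) (y : R) :
  is_derive (hermiteH n) y (2 * INR n * hermiteH (pred n) y).
Proof.
  revert y; induction n as [| |n IH1 IH2] using nat_pair_ind; intros y.
  - apply is_derive_ext with (fun _ => 1); [reflexivity|].
    simpl; auto_derive; [easy|ring].
  - apply is_derive_ext with (fun y => 2 * y); [reflexivity|].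
    unfold hermiteH; simpl; auto_derive; [easy|ring].
  - apply is_derive_ext with
      (fun y => 2 * y * hermiteH (S n) y - 2 * INR (S n) * hermiteH n y).
    { intros t; symmetry; apply (hermiteH_rec (S n)). }
    specialize (IH1 y); specialize (IH2 y); simpl pred in *.
    evar_last.
    { apply @is_derive_minus.
      - apply @is_derive_mult; [ |exact IH2|intros; apply Rmult_comm].
        apply is_derive_scal; apply is_derive_id.
      - apply is_derive_scal; exact IH1. }
    unfold minus, plus, opp, mult, one; simpl.
    change (match n with 0%nat => 1 | S _ => INR n + 1 end) with (INR (S n)).
    rewrite (hermiteH_rec n y), S_INR; ring.
Qed.

(** Every polynomial is dominated by any growing Gaussian. In the recursion, half of [eps] pays for
    the factor [2 * y] and the other half for the preceding polynomial, which is why [eps] must stay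
    general in the induction. *)
Lemma hermiteH_growth (n : nat) (eps : R) : 0 < eps ->
  exists C, 0 <= C /\ forall y, Rabs (hermiteH n y) <= C * exp (eps * y ^ 2).
Proof.
  revert eps; induction n as [| |n IH1 IH2] using nat_pair_ind; intros eps Heps.
  - exists 1; split; [lra|]; intros y.
    unfold hermiteH; simpl; rewrite Rabs_R1.
    pose proof (exp_ineq1_le (eps * (y * (y * 1)))); nra.
  - exists (1 + / eps); assert (0 < / eps) by now apply Rinv_0_lt_compat.
    split; [lra|]; intros y.
    unfold hermiteH; simpl.
    pose proof (exp_ineq1_le (eps * (y * (y * 1)))).
    assert (Rabs (2 * y) <= 1 + y ^ 2) by (apply Rabs_le; pose proof (pow2_ge_0 (y - 1)); pose proof (pow2_ge_0 (y + 1)); split; nra).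
    assert (y ^ 2 = / eps * (eps * (y * (y * 1)))) by (field; lra).
    assert (0 <= eps * (y * (y * 1))) by nra.
    nra.
  - destruct (IH1 eps Heps) as [C1 [HC1 H1]].
    destruct (IH2 (eps / 2)) as [C2 [HC2 H2]]; [lra|].
    assert (Hinv : 0 < / (eps / 2)) by (apply Rinv_0_lt_compat; lra).
    exists ((1 + / (eps / 2)) * C2 + 2 * INR (S n) * C1).
    pose proof (pos_INR (S n)).
    split; [nra|]; intros y.
    rewrite hermiteH_rec; cbn [pred].
    eapply Rle_trans; [apply Rabs_triang|].
    rewrite Rabs_Ropp, !Rabs_mult, (Rabs_pos_eq (INR (S n))), (Rabs_pos_eq 2) by lra.
    specialize (H1 y); specialize (H2 y).
    set (e := exp (eps / 2 * y ^ 2)) in *.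
    assert (He : exp (eps * y ^ 2) = e * e).
    { unfold e; rewrite <- exp_plus; f_equal; field. }
    assert (H3 : 2 * Rabs y <= (1 + / (eps / 2)) * e).
    { pose proof (exp_ineq1_le (eps / 2 * y ^ 2)) as Hexp; fold e in Hexp.
      assert (y ^ 2 = / (eps / 2) * (eps / 2 * y ^ 2)) by (field; lra).
      assert (2 * Rabs y <= 1 + y ^ 2).
      { rewrite <- (pow2_abs y); pose proof (pow2_ge_0 (Rabs y - 1)); nra. }
      assert (0 <= eps / 2 * y ^ 2) by nra.
      nra. }
    assert (2 * Rabs y * Rabs (hermiteH (S n) y) <= (1 + / (eps / 2)) * e * (C2 * e)).
    { apply Rmult_le_compat; auto; [pose proof (Rabs_pos y); lra|apply Rabs_pos]. }
    assert (2 * INR (S n) * Rabs (hermiteH n y) <= 2 * INR (S n) * (C1 * exp (eps * y ^ 2))).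
    { apply Rmult_le_compat_l; lra. }
    rewrite He in *; nra.
Qed.

(** This is the overlap integrand without its normalisations. The exponent [- 2 * y ^ 2] collects
    [- y ^ 2 / 2] twice from the modes and [- y ^ 2] from the rescaled Hermite function. *)
Definition hermite_gauss (s k : nat) (y : R) : R :=
  hermiteH s y * hermiteH k (sqrt 2 * y) * exp (- 2 * y ^ 2).

Lemma hermite_gauss_bound (s k : nat) :
  exists C, forall y, Rabs (hermite_gauss s k y) <= C * / (1 + y ^ 2).
Proof.
  (* The second polynomial is evaluated at [sqrt 2 * y], so the rates [1/2] and [1/4] use up exactly
     [y ^ 2] of the exponent [2 * y ^ 2]; the remaining [exp (- y ^ 2)] gives the decay. *)
  destruct (hermiteH_growth s (1 / 2)) as [C1 [HC1 H1]]; [lra|].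
  destruct (hermiteH_growth k (1 / 4)) as [C2 [HC2 H2]]; [lra|].
  exists (C1 * C2); intros y; unfold hermite_gauss.
  specialize (H1 y); specialize (H2 (sqrt 2 * y)).
  rewrite Rpow_mult_distr, pow2_sqrt in H2 by lra.
  rewrite 2!Rabs_mult, (Rabs_pos_eq (exp _)) by (left; apply exp_pos).
  apply Rle_trans with (C1 * exp (1 / 2 * y ^ 2) * (C2 * exp (1 / 4 * (2 * y ^ 2))) * exp (- 2 * y ^ 2)).
  { apply Rmult_le_compat_r; [left; apply exp_pos|].
    apply Rmult_le_compat; auto; apply Rabs_pos. }
  replace (1 / 4 * (2 * y ^ 2)) with (1 / 2 * y ^ 2) by field.
  replace (C1 * exp (1 / 2 * y ^ 2) * (C2 * exp (1 / 2 * y ^ 2)) * exp (- 2 * y ^ 2))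
    with (C1 * C2 * exp (- y ^ 2)).
  2: { replace (- y ^ 2) with (1 / 2 * y ^ 2 + 1 / 2 * y ^ 2 + - 2 * y ^ 2) by field.
       rewrite 2!exp_plus; ring. }
  apply Rmult_le_compat_l; [nra|].
  rewrite exp_Ropp; apply Rinv_le_contravar; [nra|apply exp_ineq1_le].
Qed.

Lemma is_lim_of_bound (f : R -> R) (C : R) (x : Rbar) :
  x = m_infty \/ x = p_infty ->
  (forall y, Rabs (f y) <= C * / (1 + y ^ 2)) -> is_lim f x 0.
Proof.
  intros Hx Hf.
  assert (Hg : is_lim (fun y => C * / (1 + y ^ 2)) x 0).
  { replace (Finite 0) with (Rbar_mult C 0) by (simpl; f_equal; ring).
    apply is_lim_scal_l.
    replace (Finite 0) with (Rbar_inv p_infty) by reflexivity.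
    apply is_lim_inv; [|discriminate].
    apply is_lim_le_p_loc with (fun y => Rabs y).
    - destruct Hx as [-> | ->]; exists 0; intros y _;
        rewrite <- (pow2_abs y); pose proof (pow2_ge_0 (Rabs y - 1)); nra.
    - replace p_infty with (Rbar_abs x) by (destruct Hx as [-> | ->]; reflexivity).
      apply is_lim_Rabs, is_lim_id. }
  apply is_lim_le_le_loc with (fun y => - (C * / (1 + y ^ 2))) (fun y => C * / (1 + y ^ 2)).
  - destruct Hx as [-> | ->]; exists 0; intros y _; specialize (Hf y);
      apply Rabs_le_between in Hf; lra.
  - replace (Finite 0) with (Rbar_opp 0) by (simpl; f_equal; ring).
    apply is_lim_opp; exact Hg.
  - exact Hg.
Qed.

(** With [z = sqrt 2 * y], differentiating [H_k(z) exp (- z^2)] raises the index to [k + 1] by the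
    three-term recursion, while differentiating [H_s] lowers [s]. For [s = 0] the factor [INR s]
    removes the spurious [pred] term. *)
Lemma is_derive_hermite_gauss (s k : nat) (y : R) :
  is_derive (hermite_gauss s k) y
    (2 * INR s * hermite_gauss (pred s) k y - sqrt 2 * hermite_gauss s (S k) y).
Proof.
  unfold hermite_gauss.
  evar_last.
  { apply @is_derive_mult; [apply @is_derive_mult| |].
    - apply is_derive_hermiteH.
    - apply (is_derive_comp (hermiteH k) (fun y => sqrt 2 * y)).
      + apply is_derive_hermiteH.
      + apply is_derive_scal, is_derive_id.
    - intros; apply Rmult_comm.
    - instantiate (1 := - 4 * y * exp (- 2 * y ^ 2)); auto_derive; [easy|ring_simplify; f_equal; f_equal; ring].
    - intros; apply Rmult_comm. }
  unfold scal, plus, mult, one; simpl; unfold mult; simpl.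
  rewrite (hermiteH_rec k).
  assert (E : sqrt 2 * sqrt 2 = 2) by (apply sqrt_sqrt; lra).
  replace (sqrt 2 * (hermiteH s y * (2 * (sqrt 2 * y) * hermiteH k (sqrt 2 * y) - 2 * INR k * hermiteH (pred k) (sqrt 2 * y)) * exp (-2 * (y * (y * 1)))))
   with (hermiteH s y * ((sqrt 2 * sqrt 2) * 2 * y * hermiteH k (sqrt 2 * y) - 2 * sqrt 2 * INR k * hermiteH (pred k) (sqrt 2 * y)) * exp (-2 * (y * (y * 1)))) by ring.
  rewrite E; ring.
Qed.

Notation is_RInt_line f l :=
  (is_RInt_gen f (Rbar_locally m_infty) (Rbar_locally p_infty) l).

(** Integration by parts: the boundary terms vanish by the decay of [hermite_gauss]. The resulting
    relation trades index [k + 1] for the pair [(s - 1, k)]. *)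
Lemma integral_derive_hermite_gauss (s k : nat) :
  is_RInt_line (fun y => 2 * INR s * hermite_gauss (pred s) k y
                        - sqrt 2 * hermite_gauss s (S k) y) 0.
Proof.
  apply is_RInt_gen_ext with (Derive (hermite_gauss s k)).
  { apply filter_forall; intros ab x _; apply is_derive_unique, is_derive_hermite_gauss. }
  destruct (hermite_gauss_bound s k) as [C HC].
  replace 0 with (0 - 0) by ring.
  apply is_RInt_gen_Derive.
  - apply filter_forall; intros ab x _; eexists; apply is_derive_hermite_gauss.
  - apply filter_forall; intros ab x _.
    apply continuous_ext with (fun y => 2 * INR s * hermite_gauss (pred s) k y
                        - sqrt 2 * hermite_gauss s (S k) y).
    { intros y; symmetry; apply is_derive_unique, is_derive_hermite_gauss. }
    apply (ex_derive_continuous (V := R_NormedModule)).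
    eexists; apply @is_derive_minus; apply is_derive_scal, is_derive_hermite_gauss.
  - apply (is_lim_of_bound _ C m_infty); auto.
  - apply (is_lim_of_bound _ C p_infty); auto.
Qed.

(** * The Gaussian integral *)

Definition gauss_primitive (c x : R) : R := RInt (fun t => exp (- c * t ^ 2)) 0 x.

Definition gauss_param (c x : R) : R :=
  RInt (fun t => exp (- c * (x ^ 2 * (1 + t ^ 2))) / (1 + t ^ 2)) 0 1.

Lemma continuous_gauss (c t : R) : continuous (fun t => exp (- c * t ^ 2)) t.
Proof.
  apply (ex_derive_continuous (V := R_NormedModule)); auto_derive; easy.
Qed.

Lemma ex_RInt_gauss (c a b : R) : ex_RInt (fun t => exp (- c * t ^ 2)) a b.
Proof.
  apply (ex_RInt_continuous (V := R_CompleteNormedModule)).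
  intros t _; apply continuous_gauss.
Qed.

Lemma ex_RInt_gauss_param (c x a b : R) :
  ex_RInt (fun t => exp (- c * (x ^ 2 * (1 + t ^ 2))) / (1 + t ^ 2)) a b.
Proof.
  apply (ex_RInt_continuous (V := R_CompleteNormedModule)).
  intros t _; apply (ex_derive_continuous (V := R_NormedModule)).
  auto_derive; nra.
Qed.

Lemma is_derive_gauss_primitive (c x : R) :
  is_derive (gauss_primitive c) x (exp (- c * x ^ 2)).
Proof.
  unfold gauss_primitive.
  apply (is_derive_RInt (V := R_NormedModule) (fun t => exp (- c * t ^ 2)) _ 0).
  - apply filter_forall; intros b.
    apply (RInt_correct (V := R_CompleteNormedModule)), ex_RInt_gauss.
  - apply continuous_gauss.
Qed.

Lemma is_derive_gauss_param (c x : R) :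
  is_derive (gauss_param c) x (- 2 * c * exp (- c * x ^ 2) * gauss_primitive c x).
Proof.
  assert (HD : forall t u, is_derive
     (fun z => exp (- c * (z ^ 2 * (1 + t ^ 2))) / (1 + t ^ 2)) u
     (- 2 * c * u * exp (- c * (u ^ 2 * (1 + t ^ 2))))).
  { intros t u; auto_derive; [nra|].
    simpl; field; nra. }
  evar_last.
  { apply (is_derive_RInt_param
       (fun z t => exp (- c * (z ^ 2 * (1 + t ^ 2))) / (1 + t ^ 2)) 0 1 x).
    - apply filter_forall; intros u t _; eexists; apply HD.
    - intros t _.
      apply continuity_2d_pt_ext with
        (fun u v => - 2 * c * u * exp (- c * (u * u * (1 + v * v)))).
      { intros u v; symmetry; etransitivity; [apply is_derive_unique, HD|].
        simpl; now rewrite !Rmult_1_r. }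
      repeat first [ apply continuity_2d_pt_mult | apply continuity_2d_pt_plus
        | apply continuity_2d_pt_const | apply continuity_2d_pt_id1
        | apply continuity_2d_pt_id2 | apply (continuity_1d_2d_pt_comp exp)
        | apply derivable_continuous, derivable_exp ].
    - apply filter_forall; intros u; apply ex_RInt_gauss_param. }
  (* The exponential factors as [exp (- c x^2) exp (- c (x t)^2)]; the form [x * t + 0] with an
     outer factor [x] is the one required by the linear substitution. *)
  rewrite (RInt_ext _ (fun t => scal (- 2 * c * exp (- c * x ^ 2))
              (scal x (exp (- c * (x * t + 0) ^ 2))))).
  2: { intros t _; etransitivity; [apply is_derive_unique, HD|].
       replace (- c * (x ^ 2 * (1 + t ^ 2)))
         with (- c * x ^ 2 + - c * (x * t + 0) ^ 2) by ring.
       rewrite exp_plus; unfold scal; simpl; unfold mult; simpl; ring. }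
  rewrite (RInt_scal (V := R_CompleteNormedModule)).
  2: { apply (ex_RInt_comp_lin (V := R_NormedModule) (fun t => exp (- c * t ^ 2))).
       apply ex_RInt_gauss. }
  etransitivity.
  { apply (f_equal (scal _)), (RInt_comp_lin (fun t => exp (- c * t ^ 2)) x 0 0 1), ex_RInt_gauss. }
  unfold gauss_primitive; rewrite Rmult_0_r, Rmult_1_r, !Rplus_0_r.
  reflexivity.
Qed.

(* Differentiating [c g^2 + h] and substituting [u = x t] in [h'] shows that the sum is
   constant; its value at [0] is [atan 1]. *)
Lemma gauss_primitive_sqr (c x : R) : 0 <= x ->
  c * gauss_primitive c x ^ 2 + gauss_param c x = PI / 4.
Proof.
  intros Hx.
  assert (H0 : c * gauss_primitive c 0 ^ 2 + gauss_param c 0 = PI / 4).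
  { unfold gauss_primitive, gauss_param; rewrite RInt_point.
    rewrite (RInt_ext _ (fun t => / (1 + t²))).
    2: { intros t _; unfold Rsqr.
         replace (- c * (0 ^ 2 * (1 + t ^ 2))) with 0 by ring.
         rewrite exp_0; simpl; rewrite Rmult_1_r; unfold Rdiv; ring. }
    rewrite <- atan_1.
    rewrite (is_RInt_unique (fun t => / (1 + t²)) 0 1 (minus (atan 1) (atan 0))).
    { rewrite atan_0; unfold minus, plus, opp, zero; simpl; ring. }
    apply (is_RInt_derive (V := R_CompleteNormedModule)).
    - intros t _; apply is_derive_atan.
    - intros t _; apply (ex_derive_continuous (V := R_NormedModule)).
      unfold Rsqr; auto_derive; nra. }
  destruct Hx as [Hx | <-]; [|exact H0].
  rewrite <- H0; symmetry.
  apply (eq_is_derive (fun x => c * gauss_primitive c x ^ 2 + gauss_param c x)); [|exact Hx].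
  intros t _.
  evar_last.
  { apply @is_derive_plus; [|apply is_derive_gauss_param].
    apply is_derive_scal.
    apply (is_derive_comp (fun z => z ^ 2)); [|apply is_derive_gauss_primitive].
    instantiate (1 := 2 * gauss_primitive c t); auto_derive; [easy|ring]. }
  unfold plus, scal, zero; simpl; unfold mult; simpl; ring.
Qed.

Lemma gauss_param_bound (c x : R) : 0 <= c -> 0 <= gauss_param c x <= exp (- c * x ^ 2).
Proof.
  intros Hc.
  assert (Hle : forall t, 0 <= exp (- c * (x ^ 2 * (1 + t ^ 2))) / (1 + t ^ 2) <= exp (- c * x ^ 2)).
  { intros t; split.
    - apply Rle_mult_inv_pos; [left; apply exp_pos|nra].
    - apply Rle_div_l; [nra|].
      assert (exp (- c * (x ^ 2 * (1 + t ^ 2))) <= exp (- c * x ^ 2)).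
      { pose proof (Rmult_le_pos c (x ^ 2 * t ^ 2)) as Hp.
        assert (0 <= x ^ 2 * t ^ 2) by (apply Rmult_le_pos; apply pow2_ge_0).
        destruct (Req_dec (- c * (x ^ 2 * (1 + t ^ 2))) (- c * x ^ 2)) as [->|Hne]; [lra|].
        left; apply exp_increasing; nra. }
      pose proof (exp_pos (- c * x ^ 2)); pose proof (pow2_ge_0 t); nra. }
  unfold gauss_param; split.
  - apply RInt_ge_0; [lra|apply ex_RInt_gauss_param|intros; apply Hle].
  - replace (exp (- c * x ^ 2)) with (RInt (fun _ => exp (- c * x ^ 2)) 0 1).
    + apply RInt_le; [lra|apply ex_RInt_gauss_param|apply ex_RInt_const|intros; apply Hle].
    + rewrite RInt_const; unfold scal; simpl; unfold mult; simpl; ring.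
Qed.

(** Since [gauss_param] vanishes at infinity, the constant value [PI / 4] is carried by
    [c * gauss_primitive ^ 2] in the limit. For [x > 0] the primitive is nonnegative, so it is the
    positive square root. *)
Lemma is_lim_gauss_primitive (c : R) : 0 < c ->
  is_lim (gauss_primitive c) p_infty (sqrt (PI / 4 / c)).
Proof.
  intros Hc.
  assert (Hh : is_lim (gauss_param c) p_infty 0).
  { apply is_lim_of_bound with (1 + / c); [now right|]; intros x.
    destruct (gauss_param_bound c x) as [H1 H2]; [lra|].
    rewrite Rabs_pos_eq by exact H1.
    apply (Rle_trans _ _ _ H2).
    (* The constant [1 + / c] works because [1 + x^2 <= (1 + / c) (1 + c x^2)] and
       [1 + c x^2 <= exp (c x^2)]. *)
    pose proof (exp_ineq1_le (c * x ^ 2)) as He.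
    pose proof (pow2_ge_0 x) as Hx.
    assert (Hc' : 0 < / c) by now apply Rinv_0_lt_compat.
    replace (- c * x ^ 2) with (- (c * x ^ 2)) by ring; rewrite exp_Ropp.
    apply Rle_div_r; [nra|].
    apply Rmult_le_reg_l with (exp (c * x ^ 2)); [apply exp_pos|].
    rewrite <- Rmult_assoc, Rinv_r by apply Rgt_not_eq, exp_pos.
    assert (x ^ 2 = / c * (c * x ^ 2)) by (field; lra).
    nra. }
  apply is_lim_ext_loc with (fun x => sqrt ((PI / 4 - gauss_param c x) / c)).
  { exists 0; intros x Hx.
    rewrite <- (gauss_primitive_sqr c x) by lra.
    replace ((c * gauss_primitive c x ^ 2 + gauss_param c x - gauss_param c x) / c)
      with (gauss_primitive c x ^ 2) by (field; lra).
    apply sqrt_pow2, RInt_ge_0; [lra|apply ex_RInt_gauss|].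
    intros; left; apply exp_pos. }
  apply (is_lim_comp_continuous (fun x => (PI / 4 - gauss_param c x) / c) sqrt).
  - apply (is_lim_scal_r _ (/ c) _ (PI / 4)).
    evar_last; [apply is_lim_minus'; [apply is_lim_const|exact Hh]|].
    f_equal; ring.
  - apply continuous_sqrt.
Qed.

Lemma gauss_primitive_odd (c x : R) : gauss_primitive c (- x) = - gauss_primitive c x.
Proof.
  pose proof (RInt_comp_lin (fun t => exp (- c * t ^ 2)) (-1) 0 0 x) as H.
  replace (-1 * 0 + 0) with 0 in H by ring.
  replace (-1 * x + 0) with (- x) in H by ring.
  unfold gauss_primitive; rewrite <- H by apply ex_RInt_gauss.
  rewrite <- (RInt_opp (V := R_CompleteNormedModule)) by apply ex_RInt_gauss.
  apply RInt_ext; intros t _.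
  replace ((-1 * t + 0) ^ 2) with (t ^ 2) by ring.
  unfold scal, opp; simpl; unfold mult; simpl; ring.
Qed.

Lemma gauss_integral (c : R) : 0 < c ->
  is_RInt_line (fun t => exp (- c * t ^ 2)) (sqrt (PI / c)).
Proof.
  intros Hc.
  apply is_RInt_gen_ext with (Derive (gauss_primitive c)).
  { apply filter_forall; intros ab x _; apply is_derive_unique, is_derive_gauss_primitive. }
  replace (sqrt (PI / c)) with (sqrt (PI / 4 / c) - - sqrt (PI / 4 / c)).
  2: { replace (PI / c) with (2 ^ 2 * (PI / 4 / c)) by (field; lra).
       pose proof PI_RGT_0.
       rewrite sqrt_mult_alt, sqrt_pow2 by lra; ring. }
  pose proof (is_lim_gauss_primitive c Hc) as Hl.
  apply is_RInt_gen_Derive.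
  - apply filter_forall; intros ab x _; eexists; apply is_derive_gauss_primitive.
  - apply filter_forall; intros ab x _.
    apply continuous_ext with (fun t => exp (- c * t ^ 2)); [|apply continuous_gauss].
    intros y; symmetry; apply is_derive_unique, is_derive_gauss_primitive.
  - change (is_lim (gauss_primitive c) m_infty (- sqrt (PI / 4 / c))).
    apply is_lim_ext with (fun x => - gauss_primitive c (- x)).
    { intros x; rewrite gauss_primitive_odd; ring. }
    apply (is_lim_opp _ _ (sqrt (PI / 4 / c))).
    apply (is_lim_comp (gauss_primitive c) Ropp m_infty _ p_infty); [exact Hl| |].
    + apply (is_lim_opp (fun x => x) m_infty m_infty), is_lim_id.
    + exists 0; discriminate.
  - exact Hl.
Qed.

(** * Closed form of the Hermite-Gauss integrals *)

(* Taylor coefficients of [exp (- z ^ 2 / 2)]. *)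
Fixpoint gauss_coef (n : nat) : R :=
  match n with
  | O => 1
  | S m => match m with O => 0 | S l => - gauss_coef l / INR n end
  end.

Lemma gauss_coef_SS (n : nat) : gauss_coef (S (S n)) = - gauss_coef n / INR (S (S n)).
Proof. reflexivity. Qed.

(** The value vanishes for [k > s] because [H_s], rewritten in the variable [sqrt 2 * y], has degree
    [s] and is orthogonal to higher Hermite polynomials. This makes the scattering map
    triangular. *)
Definition hermite_gauss_int (s k : nat) : R :=
  if (k <=? s)%nat
  then sqrt (PI / 2) * sqrt 2 ^ k * INR (fact s) * gauss_coef (s - k) else 0.

(** Integrand and value enter through equations, so that each use reduces to two algebraic
    identities. Taking [b = 0] gives plain scaling. *)
Lemma is_RInt_line_lin (a b lf lg l : R) (f g h : R -> R) :
  is_RInt_line f lf -> is_RInt_line g lg ->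
  (forall y, h y = a * f y + b * g y) -> l = a * lf + b * lg -> is_RInt_line h l.
Proof.
  intros Hf Hg Hh ->.
  apply is_RInt_gen_ext with (fun y => plus (scal a (f y)) (scal b (g y))).
  { apply filter_forall; intros ab x _; symmetry; apply Hh. }
  apply (is_RInt_gen_plus (V := R_NormedModule)); apply (is_RInt_gen_scal (V := R_NormedModule));
    assumption.
Qed.

(** Because [sqrt 2 * H_1(sqrt 2 * y) = 4 * y], integration by parts evaluates the term
    [2 * y * H_{s+1}] of the recursion. The integrals then satisfy [I(s+2) = - (s+1) I(s)], which is
    the recursion of [s! * gauss_coef s]. *)
Lemma integral_hermite_gauss_0 (s : nat) :
  is_RInt_line (hermite_gauss s 0) (hermite_gauss_int s 0).
Proof.
  assert (E : sqrt 2 * sqrt 2 = 2) by (apply sqrt_sqrt; lra).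
  assert (Hg : is_RInt_line (fun t => exp (- 2 * t ^ 2)) (sqrt (PI / 2))) by (apply gauss_integral; lra).
  induction s as [| |s IH1 _] using nat_pair_ind.
  - apply (is_RInt_line_lin 1 0 _ _ _ _ _ _ Hg Hg).
    + intros y; unfold hermite_gauss, hermiteH; simpl; ring.
    + unfold hermite_gauss_int; simpl; ring.
  - apply (is_RInt_line_lin (- / 2) 0 _ _ _ _ _ _ (integral_derive_hermite_gauss 0 0) Hg).
    + intros y; unfold hermite_gauss, hermiteH; simpl.
      replace (2 * (sqrt 2 * y)) with (2 * y * sqrt 2) by ring.
      rewrite !Rmult_1_l, !Rmult_0_r, !Rmult_0_l, Rplus_0_r.
      transitivity (2 / 2 * (2 * y * exp (-2 * (y * (y * 1))))); [field|].
      rewrite <- E at 1; field.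
    + unfold hermite_gauss_int; simpl; ring.
  - apply (is_RInt_line_lin (- / 2) (- INR (S s)) _ _ _ _ _ _
             (integral_derive_hermite_gauss (S s) 0) IH1).
    + intros y; unfold hermite_gauss; rewrite (hermiteH_rec (S s)); cbn [pred].
      assert (E1 : hermiteH 1 (sqrt 2 * y) = 2 * (sqrt 2 * y)) by reflexivity.
      rewrite E1.
      replace (sqrt 2 * (hermiteH (S s) y * (2 * (sqrt 2 * y)) * exp (-2 * y ^ 2)))
        with ((sqrt 2 * sqrt 2) * (hermiteH (S s) y * (2 * y) * exp (-2 * y ^ 2))) by ring.
      rewrite E.
      assert (E0 : hermiteH 0 (sqrt 2 * y) = 1) by reflexivity.
      rewrite E0; field.
    + unfold hermite_gauss_int; cbn [Nat.leb]; rewrite !Nat.sub_0_r, gauss_coef_SS.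
      rewrite !fact_simpl, !mult_INR; field; apply not_0_INR; lia.
Qed.

(** Induction on [k]: integration by parts gives [I(s, k+1) = sqrt 2 * s * I(s-1, k)], which
    preserves [s - k] and turns [(s-1)!] into [s!]. *)
Lemma integral_hermite_gauss (s k : nat) :
  is_RInt_line (hermite_gauss s k) (hermite_gauss_int s k).
Proof.
  assert (E : sqrt 2 * sqrt 2 = 2) by (apply sqrt_sqrt; lra).
  assert (E' : sqrt 2 <> 0) by (intros H; rewrite H in E; lra).
  revert s; induction k as [|k IH]; intros s; [apply integral_hermite_gauss_0|].
  apply (is_RInt_line_lin (2 * INR s / sqrt 2) (- / sqrt 2) _ _ _ _ _ _
           (IH (pred s)) (integral_derive_hermite_gauss s k)).
  - intros y; field; exact E'.
  - destruct s as [|s].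
    + unfold hermite_gauss_int; simpl; field; exact E'.
    + unfold hermite_gauss_int; cbn [pred Nat.leb Nat.sub].
      destruct (k <=? s)%nat; [|field; exact E'].
      rewrite fact_simpl, mult_INR, <- tech_pow_Rmult.
      apply Rmult_eq_reg_r with (sqrt 2); [|exact E'].
      transitivity (sqrt 2 * sqrt 2 * (sqrt (PI / 2) * sqrt 2 ^ k * (INR (S s) * INR (fact s)) * gauss_coef (s - k)));
       [ring|rewrite E; field; exact E'].
Qed.

(** * Overlaps and scattering coefficients *)

Lemma sqrt_pow_nat (x : R) (n : nat) : 0 <= x -> sqrt (x ^ n) = sqrt x ^ n.
Proof.
  intros Hx; induction n as [|n IH]; simpl; [apply sqrt_1|].
  rewrite sqrt_mult_alt, IH by exact Hx; reflexivity.
Qed.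

Lemma sqrt_fact_pos (n : nat) : 0 < sqrt (INR (fact n)).
Proof. apply sqrt_lt_R0, INR_fact_lt_0. Qed.

Lemma sqrt2_sqr : sqrt 2 * sqrt 2 = 2.
Proof. apply sqrt_sqrt; lra. Qed.

Lemma sqrt2_pos : 0 < sqrt 2.
Proof. apply sqrt_lt_R0; lra. Qed.

Definition ground_overlap (s k : nat) : R :=
  if (k <=? s)%nat
  then gauss_coef (s - k) * sqrt (INR (fact s)) / (sqrt (2 ^ s) * sqrt (INR (fact k))) else 0.

Lemma integral_ground_overlap (s k : nat) :
  is_RInt_line (fun y => hermite_fun s y * hermite_fun 0 y * hermite_fun_resc k y)
    (ground_overlap s k).
Proof.
  pose proof sqrt2_sqr as E2; pose proof sqrt2_pos as P2.
  pose proof PI_RGT_0 as HPI.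
  assert (HsPI : 0 < sqrt PI) by now apply sqrt_lt_R0.
  assert (HP : 0 < sqrt (sqrt PI)) by now apply sqrt_lt_R0.
  assert (EP : sqrt (sqrt PI) * sqrt (sqrt PI) = sqrt PI) by (apply sqrt_sqrt; lra).
  pose proof (sqrt_fact_pos s) as HB; pose proof (sqrt_fact_pos k) as HD.
  assert (EB : sqrt (INR (fact s)) * sqrt (INR (fact s)) = INR (fact s)) by (apply sqrt_sqrt, pos_INR).
  assert (Hsplit : forall n, sqrt (2 ^ n * INR (fact n) * sqrt PI)
                   = sqrt 2 ^ n * sqrt (INR (fact n)) * sqrt (sqrt PI)).
  { intros n.
    assert (0 <= 2 ^ n) by (apply pow_le; lra).
    pose proof (pos_INR (fact n)).
    rewrite sqrt_mult_alt, sqrt_mult_alt, sqrt_pow_nat by nra; reflexivity. }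
  assert (Hp : forall n, 0 < sqrt 2 ^ n) by (intros n; now apply pow_lt).
  (* The scalar is the product of the normalisations of [hermite_fun s] and [hermite_fun 0], the
     factor [sqrt 2 * sqrt (sqrt PI)] of the rescaling, and the normalisation of [hermite_fun k]. *)
  apply (is_RInt_line_lin
    (/ (sqrt 2 ^ s * sqrt (INR (fact s)) * sqrt (sqrt PI)) * / sqrt (sqrt PI)
     * (sqrt 2 * sqrt (sqrt PI)) * / (sqrt 2 ^ k * sqrt (INR (fact k)) * sqrt (sqrt PI)))
    0 _ _ _ _ _ _ (integral_hermite_gauss s k) (integral_hermite_gauss s k)).
  - intros y; unfold hermite_fun_resc, hermite_fun, hermite_gauss.
    rewrite !Hsplit, Rpow_mult_distr.
    replace (sqrt 2 ^ 2) with 2 by (simpl; lra).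
    replace (-2 * y ^ 2) with (- y ^ 2 / 2 + - y ^ 2 / 2 + - (2 * y ^ 2) / 2) by field.
    rewrite !exp_plus.
    change (hermiteH 0 y) with 1; change (INR (fact 0)) with 1.
    rewrite sqrt_1; simpl (sqrt 2 ^ 0); rewrite !Rmult_1_l.
    ring.
  - unfold ground_overlap, hermite_gauss_int.
    destruct (k <=? s)%nat; [|ring].
    rewrite sqrt_pow_nat by lra.
    set (B := sqrt (INR (fact s))) in *; rewrite <- EB.
    replace (sqrt (PI / 2)) with (sqrt (sqrt PI) * sqrt (sqrt PI) / sqrt 2).
    2: { rewrite EP; symmetry; apply sqrt_div_alt; lra. }
    specialize (Hp s) as Hps; specialize (Hp k) as Hpk.
    field; repeat split; lra.
Qed.

(** This is [H_1^2 = H_2 + 2 H_0] after normalisation. It reduces the overlap of two modes of index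
    [1] to overlaps with the ground state. *)
Lemma hermite_fun_1_sqr (y : R) :
  hermite_fun 1 y * hermite_fun 1 y
  = sqrt 2 * (hermite_fun 2 y * hermite_fun 0 y) + hermite_fun 0 y * hermite_fun 0 y.
Proof.
  pose proof sqrt2_sqr as E2; pose proof sqrt2_pos as P2.
  assert (HsPI : 0 < sqrt PI) by (apply sqrt_lt_R0, PI_RGT_0).
  assert (HP : 0 < sqrt (sqrt PI)) by now apply sqrt_lt_R0.
  unfold hermite_fun, hermiteH; simpl.
  set (e := exp _).
  replace (2 * 1 * 1 * sqrt PI) with (2 * sqrt PI) by ring.
  replace (2 * (2 * 1) * (1 + 1) * sqrt PI) with (2 * (2 * (2 * sqrt PI))) by ring.
  replace (1 * 1 * sqrt PI) with (sqrt PI) by ring.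
  rewrite !(sqrt_mult_alt 2) by lra.
  replace (/ (sqrt 2 * sqrt (sqrt PI)) * (2 * y) * e * (/ (sqrt 2 * sqrt (sqrt PI)) * (2 * y) * e))
    with (4 * y ^ 2 / (sqrt 2 * sqrt 2) * (e / sqrt (sqrt PI)) ^ 2) by (field; lra).
  replace (sqrt 2 * (sqrt 2 * (sqrt 2 * sqrt (sqrt PI)))) with (2 * sqrt 2 * sqrt (sqrt PI))
    by (rewrite <- E2 at 1; ring).
  rewrite E2; field; lra.
Qed.

(** * Modes and overlaps at the prescribed energies *)

Lemma Es_eq (xi : R) (s : nat) : 0 < xi -> Es xi s = xi / 2 + INR s / xi.
Proof.
  intros Hxi; unfold Es; pose proof (pos_INR s).
  (* The middle term [INR s] is the cross term of a perfect square. *)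
  replace (xi ^ 2 / 4 + INR s + INR s ^ 2 / xi ^ 2) with ((xi / 2 + INR s / xi) ^ 2)
    by (field; lra).
  apply sqrt_pow2, Rplus_le_le_0_compat; [lra|now apply Rdiv_le_0_compat].
Qed.

(* The sign of the mode is the sign of [xi / 2 - s / xi]. *)
Lemma xi_mode_Es (xi : R) (s : nat) (b : bool) : 0 < xi -> (1 <= s)%nat ->
  (if b then INR s <= xi ^ 2 / 2 else xi ^ 2 / 2 <= INR s) ->
  xi_mode (Mode s b) (Es xi s) = xi / 2 - INR s / xi.
Proof.
  intros Hxi Hs Hb; rewrite Es_eq by exact Hxi.
  destruct s as [|s]; [lia|]; unfold xi_mode, msign; cbn [midx mplus].
  set (r := INR (S s)) in *.
  replace ((xi / 2 + r / xi) ^ 2 - 2 * r) with ((xi / 2 - r / xi) ^ 2) by (field; lra).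
  assert (Hr : r / xi * xi = r) by (field; lra).
  rewrite <- Rsqr_pow2, sqrt_Rsqr_abs; destruct b.
  - rewrite Rabs_pos_eq; [ring|nra].
  - rewrite Rabs_left1; [ring|nra].
Qed.

(** Here [E - xi_m = 2 s / xi], and the radicand in [c_mode] factors as
    [(2 s / xi)^2 (1 + xi^2 / (2 s))]. This cancellation removes [xi] from the data. *)
Lemma mode_coef_Es (xi : R) (s : nat) (b : bool) : 0 < xi -> (1 <= s)%nat ->
  (if b then INR s <= xi ^ 2 / 2 else xi ^ 2 / 2 <= INR s) ->
  sqrt (1 + xi ^ 2 / (2 * INR s))
  * (c_mode (Mode s b) (Es xi s) * (Es xi s - xi_mode (Mode s b) (Es xi s))) = 1.
Proof.
  intros Hxi Hs Hb; unfold c_mode; rewrite (xi_mode_Es xi s b Hxi Hs Hb), Es_eq by exact Hxi.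
  cbn [midx].
  assert (Hr : 0 < INR s) by (apply lt_0_INR; lia).
  set (r := INR s) in *.
  assert (Hq : 0 < 2 * r / xi) by (apply Rdiv_lt_0_compat; lra).
  assert (H1 : 0 < 1 + xi ^ 2 / (2 * r)).
  { apply Rplus_lt_0_compat; [lra|apply Rdiv_lt_0_compat; [nra|lra]]. }
  replace (xi / 2 + r / xi - (xi / 2 - r / xi)) with (2 * r / xi) by (field; lra).
  rewrite pow2_abs.
  replace (2 * r + (2 * r / xi) ^ 2) with ((2 * r / xi) ^ 2 * (1 + xi ^ 2 / (2 * r)))
    by (field; lra).
  rewrite sqrt_mult_alt, sqrt_pow2 by (try apply pow2_ge_0; lra).
  apply sqrt_lt_R0 in H1.
  set (q := 2 * r / xi) in *.
  field; lra.
Qed.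

Lemma RInt_gen_line (f : R -> R) (l : R) : is_RInt_line f l ->
  RInt_gen f (Rbar_locally m_infty) (Rbar_locally p_infty) = l.
Proof. apply (is_RInt_gen_unique (V := R_CompleteNormedModule)). Qed.

(** Only the second components contribute, since the first component of the mode of index [0] is
    zero. *)
Lemma mode_overlap_ground (s : nat) (b b' : bool) (E : R) (k : nat) : (1 <= s)%nat ->
  mode_overlap (Mode s b) (Mode 0 b') E k
  = c_mode (Mode s b) E * (E - xi_mode (Mode s b) E) * ground_overlap s k.
Proof.
  intros Hs; destruct s as [|s]; [lia|].
  apply RInt_gen_line.
  apply (is_RInt_line_lin (c_mode (Mode (S s) b) E * (E - xi_mode (Mode (S s) b) E)) 0 _ _ _ _ _ _
    (integral_ground_overlap (S s) k) (integral_ground_overlap (S s) k)); [|ring].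
  intros y; unfold phi_mode1, phi_mode2; cbn [midx]; ring.
Qed.

Lemma xi_mode_E0 (xi : R) (b : bool) : 0 < xi ->
  xi_mode (Mode 1 b) (E0 xi) = (if b then 1 else -1) * (xi / 2).
Proof.
  intros Hxi; unfold xi_mode, msign; cbn [midx mplus].
  unfold E0; rewrite pow2_sqrt by nra; simpl INR.
  replace (xi ^ 2 / 4 + 2 - 2 * 1) with ((xi / 2) ^ 2) by field.
  rewrite sqrt_pow2 by lra; reflexivity.
Qed.

(** At [E^2 = xi^2 / 4 + 2] the product of the two radicands collapses to [8 E^2]. *)
Lemma c_mode_E0 (xi : R) : 0 < xi ->
  c_mode (Mode 1 true) (E0 xi) * c_mode (Mode 1 false) (E0 xi) = / (2 * sqrt 2 * E0 xi).
Proof.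
  intros Hxi; unfold c_mode; rewrite !xi_mode_E0, !pow2_abs by exact Hxi; cbn [midx]; simpl INR.
  pose proof sqrt2_sqr as E2; pose proof sqrt2_pos as P2.
  assert (HE : E0 xi ^ 2 = xi ^ 2 / 4 + 2) by (unfold E0; apply pow2_sqrt; nra).
  assert (HE0 : 0 < E0 xi) by (unfold E0; apply sqrt_lt_R0; nra).
  set (E := E0 xi) in *.
  rewrite <- Rinv_mult, <- sqrt_mult_alt by nra.
  f_equal; apply sqrt_lem_1; [nra|nra|].
  transitivity (4 * (sqrt 2 * sqrt 2) * E ^ 2); [ring|rewrite E2].
  replace ((2 * 1 + (E - 1 * (xi / 2)) ^ 2) * (2 * 1 + (E - -1 * (xi / 2)) ^ 2))
    with (4 + 4 * E ^ 2 + xi ^ 2 + (E ^ 2 - xi ^ 2 / 4) ^ 2) by field.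
  rewrite HE; field.
Qed.

(** Both component products have weight [2], because [(E - xi/2)(E + xi/2) = 2]. The integrand is
    therefore a multiple of [2 phi_0^2 + 2 phi_1^2], and the expansion of [phi_1^2] leaves rows [0]
    and [2]. *)
Lemma mode_overlap_E0 (xi : R) (k : nat) : 0 < xi ->
  mode_overlap (Mode 1 true) (Mode 1 false) (E0 xi) k
  = / (2 * sqrt 2 * E0 xi) * (4 * ground_overlap 0 k + 2 * sqrt 2 * ground_overlap 2 k).
Proof.
  intros Hxi.
  apply RInt_gen_line.
  apply (is_RInt_line_lin (/ (2 * sqrt 2 * E0 xi) * 4) (/ (2 * sqrt 2 * E0 xi) * (2 * sqrt 2)) _ _ _ _ _ _
    (integral_ground_overlap 0 k) (integral_ground_overlap 2 k)); [|ring].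
  intros y; rewrite <- (c_mode_E0 xi Hxi).
  unfold phi_mode1, phi_mode2; cbn [midx]; rewrite !xi_mode_E0 by exact Hxi.
  assert (HE : E0 xi ^ 2 = xi ^ 2 / 4 + 2) by (unfold E0; apply pow2_sqrt; nra).
  set (E := E0 xi) in *; set (c := c_mode _ _); set (c' := c_mode _ _).
  replace (2 * INR 1) with 2 by (simpl; ring).
  transitivity (c * c' * ((sqrt 2 * sqrt 2) * (hermite_fun 0 y * hermite_fun 0 y)
      + (E ^ 2 - xi ^ 2 / 4) * (hermite_fun 1 y * hermite_fun 1 y)) * hermite_fun_resc k y); [field|].
  rewrite sqrt2_sqr, HE, hermite_fun_1_sqr; field.
Qed.

(** * The data as finite sums *)

Lemma CSeries_finite (f : nat -> C) (n : nat) :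
  (forall k, (n < k)%nat -> f k = 0) -> CSeries f = sum_n f n.
Proof.
  intros Hf.
  assert (HS : forall g : nat -> R, (forall k, (n < k)%nat -> g k = 0) -> Series g = sum_n g n).
  { intros g Hg; apply is_series_unique.
    change (is_lim_seq (sum_n g) (sum_n g n)).
    apply (is_lim_seq_ext_loc (fun _ => sum_n g n)); [|apply is_lim_seq_const].
    exists n; intros m Hm; induction Hm as [|m Hm IH]; [reflexivity|].
    rewrite sum_Sn, Hg, <- IH by lia.
    symmetry; apply Rplus_0_r. }
  unfold CSeries; rewrite !HS by (intros k Hk; rewrite Hf by exact Hk; reflexivity).
  clear; induction n as [|n IH]; [rewrite !sum_O; destruct (f 0%nat); reflexivity|].
  rewrite !sum_Sn, <- IH; reflexivity.
Qed.

(** Extension by zero lets finite and infinite [N] share the same formulas. *)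
Definition ext_trunc (N : ext_nat) (a : nat -> C) (k : nat) : C :=
  if le_ext k N then a k else 0.

Definition ground_transform (a : nat -> C) (s : nat) : C :=
  sum_n (fun k => (a k * RtoC (ground_overlap s k))%C) s.

(** The overlaps vanish beyond a fixed index, so the series is a finite sum even for [N = Inf]. The
    energy-dependent factor [q] is pulled out to meet the prefactor. *)
Lemma Slin_eq (N : ext_nat) (a : nat -> C) (E q : R) (m p : mode) (f : nat -> R) (n : nat) :
  (forall k, mode_overlap m p E k = q * f k) ->
  (forall k, (n < k)%nat -> f k = 0) ->
  Slin N a E m p
  = (Ci * RtoC (E / sqrt (E ^ 2 - 2 * INR (midx p)) * q)
     * sum_n (fun k => ext_trunc N a k * RtoC (f k)) n)%C.
Proof.
  intros Hf Hn; unfold Slin.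
  rewrite CSeries_finite with (n := n).
  - rewrite RtoC_mult, !Cmult_assoc, <- (Cmult_assoc _ (RtoC q)).
    f_equal.
    transitivity (sum_n (fun k => mult (RtoC q) (ext_trunc N a k * RtoC (f k))%C) n);
      [|apply (sum_n_mult_l (K := C_Ring))].
    apply sum_n_ext; intros k; unfold ext_trunc, mult; simpl.
    rewrite Hf, RtoC_mult; destruct (le_ext k N); ring.
  - intros k Hk; destruct (le_ext k N); [|reflexivity].
    rewrite Hf, Hn, Rmult_0_r by exact Hk; apply Cmult_0_r.
Qed.

Lemma ground_overlap_gt (s k : nat) : (s < k)%nat -> ground_overlap s k = 0.
Proof.
  intros H; unfold ground_overlap; destruct (Nat.leb_spec k s); [lia|reflexivity].
Qed.

Lemma Stilde_S (N : ext_nat) (xi : R) (a : nat -> C) (s : nat) : 0 < xi -> (1 <= s)%nat ->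
  Stilde N xi a s = (Ci * ground_transform (ext_trunc N a) s)%C.
Proof.
  intros Hxi Hs.
  (* One argument serves both signs; the non-strict inequalities match the two outcomes of
     [Rlt_dec]. *)
  assert (Hmain : forall b : bool,
    (if b then INR s <= xi ^ 2 / 2 else xi ^ 2 / 2 <= INR s) ->
    (RtoC (sqrt (1 + xi ^ 2 / (2 * INR s))) * Slin N a (Es xi s) (Mode s b) (Mode 0 false))%C
    = (Ci * ground_transform (ext_trunc N a) s)%C).
  { intros b Hb.
    rewrite (Slin_eq N a _ _ _ _ _ s (fun k => mode_overlap_ground s b false (Es xi s) k Hs)
               (fun k => ground_overlap_gt s k)).
    pose proof (mode_coef_Es xi s b Hxi Hs Hb) as Hc.
    assert (HE : 0 < Es xi s).
    { rewrite Es_eq by exact Hxi; apply Rplus_lt_le_0_compat; [lra|].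
      apply Rdiv_le_0_compat; [apply pos_INR|exact Hxi]. }
    assert (HE' : Es xi s / sqrt (Es xi s ^ 2 - 2 * INR (midx (Mode 0 false))) = 1).
    { simpl INR; rewrite Rmult_0_r, Rminus_0_r, sqrt_pow2 by lra; field; lra. }
    rewrite HE', Rmult_1_l.
    rewrite !Cmult_assoc, (Cmult_comm _ Ci), <- (Cmult_assoc Ci), <- RtoC_mult, Hc.
    rewrite Cmult_1_r; reflexivity. }
  unfold Stilde; destruct s as [|s]; [lia|].
  destruct (Rlt_dec (INR (S s)) (xi ^ 2 / 2)); apply Hmain; lra.
Qed.

Lemma sqrt_fact_2 : sqrt (INR (fact 2)) = sqrt 2.
Proof. reflexivity. Qed.

Lemma ground_overlap_0_0 : ground_overlap 0 0 = 1.
Proof. unfold ground_overlap; simpl; rewrite sqrt_1; field. Qed.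

Lemma sqrt_4 : sqrt (2 ^ 2) = 2.
Proof. apply sqrt_pow2; lra. Qed.

Lemma ground_overlap_2_0 : ground_overlap 2 0 = - sqrt 2 / 4.
Proof.
  unfold ground_overlap; cbn [Nat.leb Nat.sub]; rewrite sqrt_4, sqrt_fact_2, gauss_coef_SS.
  change (gauss_coef 0) with 1; change (INR 2) with 2; change (INR (fact 0)) with 1.
  rewrite sqrt_1; field.
Qed.

Lemma ground_overlap_2_1 : ground_overlap 2 1 = 0.
Proof. unfold ground_overlap; simpl; unfold Rdiv; ring. Qed.

Lemma ground_overlap_2_2 : ground_overlap 2 2 = / 2.
Proof.
  unfold ground_overlap; cbn [Nat.leb Nat.sub gauss_coef]; rewrite sqrt_4, sqrt_fact_2.
  pose proof sqrt2_pos; field; lra.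
Qed.

Lemma Stilde_0 (N : ext_nat) (xi : R) (a : nat -> C) : 0 < xi ->
  Stilde N xi a 0
  = (Ci * (RtoC (3 / 2) * ext_trunc N a 0 + RtoC (sqrt 2 / 2) * ext_trunc N a 2))%C.
Proof.
  intros Hxi; unfold Stilde.
  rewrite (Slin_eq N a _ _ _ _ (fun k => 4 * ground_overlap 0 k + 2 * sqrt 2 * ground_overlap 2 k) 2
             (fun k => mode_overlap_E0 xi k Hxi)).
  2: { intros k Hk; rewrite !ground_overlap_gt by lia; ring. }
  rewrite !sum_Sn, sum_O, ground_overlap_0_0, ground_overlap_2_0, ground_overlap_2_1,
    ground_overlap_2_2, !ground_overlap_gt by lia.
  assert (HE : E0 xi ^ 2 = xi ^ 2 / 4 + 2) by (unfold E0; apply pow2_sqrt; nra).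
  assert (HE0 : 0 < E0 xi) by (unfold E0; apply sqrt_lt_R0; nra).
  pose proof sqrt2_pos as P2; pose proof sqrt2_sqr as E2.
  cbn [midx]; simpl INR; rewrite HE.
  replace (xi ^ 2 / 4 + 2 - 2 * 1) with ((xi / 2) ^ 2) by field.
  rewrite sqrt_pow2 by lra.
  replace (4 * 1 + 2 * sqrt 2 * (- sqrt 2 / 4)) with 3.
  2: { transitivity (4 - (sqrt 2 * sqrt 2) / 2); [rewrite E2|]; field. }
  replace (4 * 0 + 2 * sqrt 2 * 0) with 0 by ring.
  replace (4 * 0 + 2 * sqrt 2 * / 2) with (sqrt 2) by field.
  unfold plus; simpl.
  (* The energy cancels in [q], leaving [1 / (sqrt 2 * xi)]; the prefactor [sqrt 2 / 2 * xi] of the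
     data is what turns this into [1/2]. *)
  set (q := E0 xi / (xi / 2) * / (2 * sqrt 2 * E0 xi)).
  assert (Hq : sqrt 2 / 2 * xi * q = / 2) by (unfold q; field; lra).
  transitivity (Ci * (RtoC (sqrt 2 / 2 * xi * q) * (ext_trunc N a 0 * RtoC 3
      + ext_trunc N a 1 * RtoC 0 + ext_trunc N a 2 * RtoC (sqrt 2))))%C.
  { rewrite (RtoC_mult (sqrt 2 / 2 * xi)); ring. }
  rewrite Hq; unfold Rdiv; rewrite !RtoC_mult; ring.
Qed.

(** * The norm estimate *)

Lemma sum_Sn_R (u : nat -> R) (n : nat) : sum_n u (S n) = sum_n u n + u (S n) :> R.
Proof. exact (sum_Sn u n). Qed.

Lemma sum_n_le_Series (u : nat -> R) (n : nat) :
  (forall k, 0 <= u k) -> ex_series u -> sum_n u n <= Series u.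
Proof.
  intros Hu Hex.
  apply (is_lim_seq_incr_compare (sum_n u)); [apply Series_correct, Hex|].
  intros k; rewrite sum_Sn_R; specialize (Hu (S k)); lra.
Qed.

Lemma term_le_Series (u : nat -> R) (n : nat) :
  (forall k, 0 <= u k) -> ex_series u -> u n <= Series u.
Proof.
  intros Hu Hex; apply Rle_trans with (sum_n u n); [|now apply sum_n_le_Series].
  destruct n as [|n]; [rewrite sum_O; apply Rle_refl|].
  rewrite sum_Sn_R; enough (0 <= sum_n u n) by lra.
  induction n as [|n IH]; [rewrite sum_O; apply Hu|].
  rewrite sum_Sn_R; specialize (Hu (S n)); lra.
Qed.

(* A geometric majorant of [gauss_coef]; the value [2] at [0] gives it a uniform recursion. *)
Fixpoint geom_coef (n : nat) : R :=
  match n with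
  | O => 2
  | S m => match m with O => 0 | S l => geom_coef l / 4 end
  end.

Lemma gauss_coef_le_geom (n : nat) : Rabs (gauss_coef n) <= geom_coef n.
Proof.
  induction n as [| |n IH _] using nat_pair_ind.
  - simpl; rewrite Rabs_R1; lra.
  - simpl; rewrite Rabs_R0; lra.
  - rewrite gauss_coef_SS; change (geom_coef (S (S n))) with (geom_coef n / 4).
    unfold Rdiv; rewrite Rabs_mult, Rabs_Ropp, Rabs_inv, (Rabs_pos_eq (INR _)) by apply pos_INR.
    (* For [n = 0] the bound is the equality [1/2 = 2/4], and for [n = 1] both sides vanish. From
       [n = 2] on the divisor [n + 2] is at least [4]. *)
    destruct n as [|[|n]].
    + simpl; rewrite Rabs_R1; lra.
    + simpl gauss_coef; simpl geom_coef; rewrite Rabs_R0; lra.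
    + apply Rmult_le_compat; [apply Rabs_pos| |exact IH|].
      * left; apply Rinv_0_lt_compat, lt_0_INR; lia.
      * apply Rinv_le_contravar; [lra|].
        rewrite !S_INR; pose proof (pos_INR n); lra.
Qed.

(** The diagonal term [k = s] is left out: this majorises only the deviation of the transform from
    its diagonal. Row [0] has no such term. *)
Definition geom_conv (u : nat -> R) (s : nat) : R :=
  match s with
  | O => 0
  | S r => sum_n (fun k => u k * geom_coef (s - k)) r
  end.

(** A shift by two divides the old coefficients by [4]; of the two new terms, [k = s] has
    coefficient [1/2] and [k = s + 1] has coefficient [0]. *)
Lemma geom_conv_SS (u : nat -> R) (s : nat) :
  geom_conv u (S (S s)) = u s / 2 + geom_conv u s / 4.
Proof.
  destruct s as [|s]; unfold geom_conv.
  { rewrite sum_Sn, sum_O; unfold plus; simpl; field. }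
  rewrite !sum_Sn.
  replace (S (S (S s)) - S (S s))%nat with 1%nat by lia.
  replace (S (S (S s)) - S s)%nat with 2%nat by lia.
  rewrite (sum_n_ext_loc _ (fun k => mult (/ 4) (u k * geom_coef (S s - k)))).
  2: { intros k Hk; replace (S (S (S s)) - k)%nat with (S (S (S s - k))) by lia.
       change (geom_coef (S (S (S s - k)))) with (geom_coef (S s - k) / 4).
       unfold mult; simpl; field. }
  rewrite (sum_n_mult_l (K := R_Ring)).
  change (/ 4 * geom_conv u (S s) + u (S s) * geom_coef 2 + u (S (S s)) * geom_coef 1
    = u (S s) / 2 + geom_conv u (S s) / 4).
  generalize (geom_conv u (S s)); intros g; simpl; field.
Qed.

Lemma geom_conv_pos (u : nat -> R) (s : nat) : (forall k, 0 <= u k) -> 0 <= geom_conv u s.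
Proof.
  intros Hu; induction s as [| |s IH _] using nat_pair_ind.
  - apply Rle_refl.
  - unfold geom_conv; rewrite sum_O; simpl; lra.
  - rewrite geom_conv_SS; specialize (Hu s); lra.
Qed.

Lemma sum_geom_conv_SS (u : nat -> R) (n : nat) :
  sum_n (geom_conv u) (S (S n)) = sum_n u n / 2 + sum_n (geom_conv u) n / 4 :> R.
Proof.
  induction n as [|n IH].
  - rewrite !sum_Sn, !sum_O, geom_conv_SS.
    replace (geom_conv u 1) with 0 by (unfold geom_conv; rewrite sum_O; simpl; ring).
    unfold plus; simpl; ring.
  - rewrite sum_Sn_R, IH, geom_conv_SS, !sum_Sn_R; field.
Qed.

(** The constant is the geometric sum [1/2 + 1/8 + ...], that is, the fixed point of [c = 1/2 + c/4]
    in the two-step recursion of the partial sums. *)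
Lemma sum_geom_conv_le (u : nat -> R) (n : nat) : (forall k, 0 <= u k) ->
  sum_n (geom_conv u) n <= 2 / 3 * sum_n u n.
Proof.
  intros Hu; induction n as [| |n IH _] using nat_pair_ind.
  - rewrite !sum_O; simpl; specialize (Hu 0%nat); lra.
  - rewrite !sum_Sn, !sum_O; unfold geom_conv; rewrite sum_O; unfold plus; simpl.
    pose proof (Hu 0%nat); pose proof (Hu 1%nat); lra.
  - rewrite sum_geom_conv_SS, !sum_Sn_R.
    pose proof (Hu (S n)); pose proof (Hu (S (S n))); lra.
Qed.

Lemma geom_conv_series (u : nat -> R) : (forall k, 0 <= u k) -> ex_series u ->
  ex_series (geom_conv u) /\ Series (geom_conv u) <= 2 / 3 * Series u.
Proof.
  intros Hu Hex.
  assert (Hb : forall n, sum_n (geom_conv u) n <= 2 / 3 * Series u).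
  { intros n; apply (Rle_trans _ _ _ (sum_geom_conv_le u n Hu)).
    apply Rmult_le_compat_l; [lra|now apply sum_n_le_Series]. }
  assert (Hc : ex_series (geom_conv u)).
  { apply (ex_finite_lim_seq_incr (sum_n (geom_conv u)) (2 / 3 * Series u)); [|exact Hb].
    intros n; rewrite sum_Sn_R; pose proof (geom_conv_pos u (S n) Hu); lra. }
  split; [exact Hc|].
  apply (is_lim_seq_le (sum_n (geom_conv u)) (fun _ => 2 / 3 * Series u)
           (Series (geom_conv u)) (2 / 3 * Series u)); [exact Hb| |apply is_lim_seq_const].
  apply Series_correct, Hc.
Qed.

(** Write [U], [V] for the sums from index [1] on. The convolution bound gives
    [V <= 5/3 U + 2/3 u_0] and [U <= 3 V + 2 u_0]. With [v_0 <= 3/2 u_0 + U] the first yields the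
    factor [4]; with [u_0 <= v_0 + V] the second yields [u_0 + U <= 3 v_0 + 6 V], hence the factor
    [6]. *)
Lemma perturbed_series_bounds (u v : nat -> R) :
  (forall s, 0 <= u s) -> (forall s, 0 <= v s) ->
  (forall s, v (S s) <= u (S s) + geom_conv u (S s)) ->
  (forall s, u (S s) <= v (S s) + geom_conv u (S s)) ->
  v 0%nat <= 3 / 2 * u 0%nat + u 2%nat -> u 0%nat <= v 0%nat + v 2%nat ->
  ex_series u ->
  ex_series v /\ Series u <= 6 * Series v /\ Series v <= 4 * Series u.
Proof.
  intros Hu Hv Hvu Huv Hv0 Hu0 Hex.
  destruct (geom_conv_series u Hu Hex) as [Hmex Hm].
  assert (Hu' : ex_series (fun s => u (S s))) by now apply -> (ex_series_incr_1 (K := R_AbsRing) (V := R_NormedModule)).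
  assert (Hm' : ex_series (fun s => geom_conv u (S s))) by now apply -> (ex_series_incr_1 (K := R_AbsRing) (V := R_NormedModule)).
  assert (Hum : ex_series (fun s => u (S s) + geom_conv u (S s)))
    by now apply (ex_series_plus (V := R_NormedModule)).
  assert (Hv' : ex_series (fun s => v (S s))).
  { apply (ex_series_le (V := R_CompleteNormedModule)) with (2 := Hum).
    intros s; unfold norm; simpl; unfold abs; simpl; rewrite Rabs_pos_eq; auto. }
  assert (Hvex : ex_series v) by now apply (ex_series_incr_1 (K := R_AbsRing) (V := R_NormedModule)).
  assert (Hvm : ex_series (fun s => v (S s) + geom_conv u (S s)))
    by now apply (ex_series_plus (V := R_NormedModule)).
  split; [exact Hvex|].
  assert (H1 : Series (fun s => v (S s)) <= Series (fun s => u (S s)) + Series (fun s => geom_conv u (S s))).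
  { rewrite <- Series_plus by assumption; apply Series_le; [|exact Hum]; auto. }
  assert (H2 : Series (fun s => u (S s)) <= Series (fun s => v (S s)) + Series (fun s => geom_conv u (S s))).
  { rewrite <- Series_plus by assumption; apply Series_le; [|exact Hvm]; auto. }
  (* Index [1] of the shifted sequences is the term [u 2], respectively [v 2], of the row [0]
     hypotheses. *)
  assert (H3 := term_le_Series (fun s => u (S s)) 1 (fun s => Hu (S s)) Hu').
  assert (H4 := term_le_Series (fun s => v (S s)) 1 (fun s => Hv (S s)) Hv').
  rewrite (Series_incr_1 (geom_conv u)) in Hm by assumption.
  rewrite (Series_incr_1 u), (Series_incr_1 v) in * by assumption.
  change (geom_conv u 0) with 0 in Hm; cbn beta in H3, H4; pose proof (Hu 0%nat); pose proof (Hv 0%nat).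
  pose proof (Hu 2%nat); pose proof (Hv 2%nat); lra.
Qed.

(** * Comparing the weighted data with the coefficients *)

Lemma Cmod_sum_n_le (f : nat -> C) (g : nat -> R) (n : nat) :
  (forall k, (k <= n)%nat -> Cmod (f k) <= g k) -> Cmod (sum_n f n) <= sum_n g n.
Proof.
  intros H; induction n as [|n IH]; [rewrite !sum_O; auto|].
  rewrite !sum_Sn; eapply Rle_trans; [apply Cmod_triangle|].
  apply Rplus_le_compat; auto.
Qed.

Lemma Cmod_Ci_mult (z : C) : Cmod (Ci * z) = Cmod z.
Proof.
  rewrite Cmod_mult; replace (Cmod Ci) with 1; [ring|].
  unfold Cmod, Ci; simpl; symmetry; etransitivity; [|exact sqrt_1]; f_equal; ring.
Qed.

Lemma ground_overlap_diag (s : nat) : ground_overlap s s = / sqrt (2 ^ s).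
Proof.
  unfold ground_overlap; rewrite Nat.leb_refl, Nat.sub_diag; simpl gauss_coef.
  pose proof (sqrt_fact_pos s).
  assert (0 < sqrt (2 ^ s)) by (apply sqrt_lt_R0, pow_lt; lra).
  field; lra.
Qed.

Definition ground_tail (a : nat -> C) (s : nat) : C :=
  match s with
  | O => 0
  | S r => sum_n (fun k => (a k * RtoC (ground_overlap s k))%C) r
  end.

Lemma ground_transform_diag (a : nat -> C) (s : nat) :
  ground_transform a s = (ground_tail a s + a s * RtoC (/ sqrt (2 ^ s)))%C.
Proof.
  unfold ground_transform; rewrite <- ground_overlap_diag.
  destruct s as [|s]; [rewrite sum_O; simpl; ring|].
  rewrite sum_Sn; reflexivity.
Qed.

(** The weights of the two norms cancel the factor [sqrt (s! / (2^s k!))] of [ground_overlap], so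
    only [gauss_coef (s - k)] remains to be majorised. *)
Lemma ground_tail_bound (a : nat -> C) (s : nat) :
  sqrt (2 ^ s) * Cmod (ground_tail a s) / sqrt (INR (fact s))
  <= geom_conv (fun k => Cmod (a k) / sqrt (INR (fact k))) s.
Proof.
  destruct s as [|s].
  { simpl; rewrite Cmod_0; unfold Rdiv; rewrite Rmult_0_r, Rmult_0_l; apply Rle_refl. }
  pose proof (sqrt_fact_pos (S s)) as Hf.
  assert (Hp : 0 < sqrt (2 ^ S s)) by (apply sqrt_lt_R0, pow_lt; lra).
  unfold ground_tail, geom_conv.
  set (u := sum_n (fun k => _ / _ * _) s).
  assert (Cmod (sum_n (fun k => (a k * RtoC (ground_overlap (S s) k))%C) s)
    <= sqrt (INR (fact (S s))) / sqrt (2 ^ S s) * u).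
  { unfold u.
    replace (sqrt (INR (fact (S s))) / sqrt (2 ^ S s) * sum_n _ s)
      with (sum_n (fun k => mult (sqrt (INR (fact (S s))) / sqrt (2 ^ S s))
         (Cmod (a k) / sqrt (INR (fact k)) * geom_coef (S s - k))) s)
      by apply (sum_n_mult_l (K := R_Ring)).
    apply Cmod_sum_n_le; intros k Hk.
    pose proof (sqrt_fact_pos k) as Hfk.
    rewrite Cmod_mult, Cmod_R; unfold ground_overlap.
    destruct (Nat.leb_spec k (S s)); [|lia].
    unfold Rdiv at 1; rewrite !Rabs_mult.
    rewrite (Rabs_pos_eq (/ _)) by (left; apply Rinv_0_lt_compat; nra).
    rewrite (Rabs_pos_eq (sqrt _)) by lra.
    set (c := Cmod (a k) * sqrt (INR (fact (S s))) / (sqrt (2 ^ S s) * sqrt (INR (fact k)))).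
    apply Rle_trans with (c * Rabs (gauss_coef (S s - k))); [right; unfold c; field; lra|].
    apply Rle_trans with (c * geom_coef (S s - k));
      [|right; unfold c, mult; cbn -[fact pow INR geom_coef Nat.sub]; field; lra].
    apply Rmult_le_compat_l; [|apply gauss_coef_le_geom].
    apply Rdiv_le_0_compat; [|nra].
    apply Rmult_le_pos; [apply Cmod_ge_0|lra]. }
  apply Rle_div_l; [exact Hf|].
  apply Rle_trans with (sqrt (2 ^ S s) * (sqrt (INR (fact (S s))) / sqrt (2 ^ S s) * u)).
  { apply Rmult_le_compat_l; lra. }
  right; field; lra.
Qed.

(** The diagonal entry [/ sqrt (2 ^ s)] is undone by the weight of the data norm; the reverse
    triangle inequality leaves the off-diagonal part. *)
Lemma ground_transform_perturbation (a : nat -> C) (s : nat) :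
  Rabs (sqrt (2 ^ s) * Cmod (ground_transform a s) / sqrt (INR (fact s))
        - Cmod (a s) / sqrt (INR (fact s)))
  <= geom_conv (fun k => Cmod (a k) / sqrt (INR (fact k))) s.
Proof.
  eapply Rle_trans; [|apply ground_tail_bound].
  pose proof (sqrt_fact_pos s) as Hf.
  assert (Hp : 0 < sqrt (2 ^ s)) by (apply sqrt_lt_R0, pow_lt; lra).
  replace (sqrt (2 ^ s) * Cmod (ground_transform a s) / sqrt (INR (fact s))
        - Cmod (a s) / sqrt (INR (fact s)))
    with (sqrt (2 ^ s) / sqrt (INR (fact s))
          * (Cmod (ground_transform a s) - Cmod (a s * RtoC (/ sqrt (2 ^ s))))).
  2: { rewrite Cmod_mult, Cmod_R, (Rabs_pos_eq (/ _)) by (left; now apply Rinv_0_lt_compat).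
       field; lra. }
  replace (sqrt (2 ^ s) * Cmod (ground_tail a s) / sqrt (INR (fact s)))
    with (sqrt (2 ^ s) / sqrt (INR (fact s)) * Cmod (ground_tail a s)) by (field; lra).
  assert (Hq : 0 <= sqrt (2 ^ s) / sqrt (INR (fact s))) by (apply Rdiv_le_0_compat; lra).
  rewrite Rabs_mult, (Rabs_pos_eq _ Hq).
  apply Rmult_le_compat_l; [exact Hq|].
  rewrite ground_transform_diag.
  set (x := ground_tail a s); set (y := (a s * _)%C).
  pose proof (Cmod_triangle x y) as H1.
  pose proof (Cmod_triangle (x + y) (- x)) as H2.
  replace (x + y + - x)%C with y in H2 by ring.
  rewrite Cmod_opp in H2.
  apply Rabs_le; lra.
Qed.

Lemma V_term_trunc (N : ext_nat) (a : nat -> C) (s : nat) :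
  V_term N a s = Cmod (ext_trunc N a s) / sqrt (INR (fact s)).
Proof.
  unfold V_term, ext_trunc; destruct (le_ext s N); [reflexivity|].
  rewrite Cmod_0; unfold Rdiv; ring.
Qed.

Lemma V_term_pos (N : ext_nat) (a : nat -> C) (s : nat) : 0 <= V_term N a s.
Proof.
  rewrite V_term_trunc; apply Rdiv_le_0_compat; [apply Cmod_ge_0|apply sqrt_fact_pos].
Qed.

Lemma S_term_pos (N : ext_nat) (a : nat -> C) (s : nat) : 0 <= S_term N a s.
Proof.
  unfold S_term; destruct (le_ext s N); [|apply Rle_refl].
  apply Rdiv_le_0_compat; [|apply sqrt_fact_pos].
  apply Rmult_le_pos; [apply sqrt_pos|apply Cmod_ge_0].
Qed.

Lemma geom_conv_ext (u v : nat -> R) (s : nat) :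
  (forall k, u k = v k) -> geom_conv u s = geom_conv v s.
Proof.
  intros H; destruct s as [|s]; [reflexivity|].
  apply sum_n_ext; intros k; now rewrite H.
Qed.

Lemma Stilde_perturbation (N : ext_nat) (xi : R) (a : nat -> C) (s : nat) : 0 < xi -> (1 <= s)%nat ->
  Rabs (S_term N (Stilde N xi a) s - V_term N a s) <= geom_conv (V_term N a) s.
Proof.
  intros Hxi Hs; unfold S_term.
  destruct (le_ext s N) eqn:HN.
  - rewrite (geom_conv_ext _ _ s (V_term_trunc N a)), V_term_trunc.
    rewrite Stilde_S, Cmod_Ci_mult by assumption.
    apply ground_transform_perturbation.
  - unfold V_term at 1; rewrite HN, Rminus_0_r, Rabs_R0.
    apply geom_conv_pos, V_term_pos.
Qed.

Lemma le_ext_0 (N : ext_nat) : le_ext 0 N = true.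
Proof. destruct N; reflexivity. Qed.

Lemma ground_transform_2 (a : nat -> C) :
  ground_transform a 2 = (RtoC (- sqrt 2 / 4) * a 0%nat + RtoC (/ 2) * a 2%nat)%C.
Proof.
  unfold ground_transform.
  rewrite !sum_Sn, sum_O, ground_overlap_2_0, ground_overlap_2_1, ground_overlap_2_2.
  unfold plus; simpl; ring.
Qed.

(** Row [0] and [sqrt 2] times row [2] have the same coefficient on [a_2], so their difference
    isolates [a_0]. The identity also holds when [N] cuts off index [2], since [Stilde] is defined
    at every index. *)
Lemma Stilde_0_2 (N : ext_nat) (xi : R) (a : nat -> C) : 0 < xi ->
  Stilde N xi a 0 = (RtoC (sqrt 2) * Stilde N xi a 2 + 2 * Ci * a 0%nat)%C.
Proof.
  intros Hxi; rewrite Stilde_0, Stilde_S, ground_transform_2 by (exact Hxi || lia).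
  assert (H0 : ext_trunc N a 0 = a 0%nat) by (unfold ext_trunc; now rewrite le_ext_0).
  rewrite H0.
  assert (H1 : RtoC (3 / 2) = (RtoC (sqrt 2) * RtoC (- sqrt 2 / 4) + 2)%C).
  { rewrite <- RtoC_mult, <- RtoC_plus; f_equal.
    transitivity (2 - (sqrt 2 * sqrt 2) / 4); [rewrite sqrt2_sqr|]; field. }
  assert (H2 : RtoC (sqrt 2 / 2) = (RtoC (sqrt 2) * RtoC (/ 2))%C) by apply RtoC_mult.
  rewrite H1, H2; ring.
Qed.

Lemma S_term_0_bound (N : ext_nat) (xi : R) (a : nat -> C) : 0 < xi ->
  S_term N (Stilde N xi a) 0 <= 3 / 2 * V_term N a 0 + V_term N a 2.
Proof.
  intros Hxi; rewrite !V_term_trunc, sqrt_fact_2; unfold S_term; rewrite le_ext_0.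
  rewrite Stilde_0, Cmod_Ci_mult by exact Hxi; simpl (2 ^ 0); simpl (INR (fact 0)).
  rewrite sqrt_1; unfold Rdiv; rewrite Rinv_1, !Rmult_1_r, Rmult_1_l.
  eapply Rle_trans; [apply Cmod_triangle|].
  rewrite !Cmod_mult, !Cmod_R, !Rabs_pos_eq by (pose proof sqrt2_pos; lra).
  right; f_equal.
  pose proof sqrt2_pos; rewrite Rmult_comm; f_equal.
  apply Rmult_eq_reg_l with (sqrt 2); [|lra].
  rewrite Rinv_r, <- Rmult_assoc, sqrt2_sqr by lra; field.
Qed.

Lemma V_term_0_bound (N : ext_nat) (xi : R) (a : nat -> C) : 0 < xi ->
  V_term N a 0 <= S_term N (Stilde N xi a) 0 + S_term N (Stilde N xi a) 2.
Proof.
  intros Hxi; unfold V_term, S_term; rewrite le_ext_0.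
  rewrite sqrt_4, sqrt_fact_2; simpl (2 ^ 0); simpl (INR (fact 0)).
  rewrite sqrt_1; unfold Rdiv; rewrite Rinv_1, !Rmult_1_r, Rmult_1_l.
  pose proof (Cmod_ge_0 (a 0%nat)) as Ha.
  pose proof sqrt2_pos as P2; pose proof sqrt2_sqr as E2.
  destruct (le_ext 2 N) eqn:HN.
  - replace (2 * Cmod (Stilde N xi a 2) * / sqrt 2) with (sqrt 2 * Cmod (Stilde N xi a 2)).
    2: { rewrite <- E2 at 2; field; lra. }
    pose proof (Cmod_triangle (Stilde N xi a 0) (- (RtoC (sqrt 2) * Stilde N xi a 2))) as H.
    rewrite (Stilde_0_2 N xi a Hxi) in H at 1.
    replace (RtoC (sqrt 2) * Stilde N xi a 2 + 2 * Ci * a 0%nat + - (RtoC (sqrt 2) * Stilde N xi a 2))%C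
      with (Ci * (2 * a 0%nat))%C in H by ring.
    rewrite Cmod_Ci_mult, Cmod_opp, !Cmod_mult, !Cmod_R, !Rabs_pos_eq in H by lra.
    lra.
  (* When index [2] is truncated its data term is [0], and row [0] alone suffices: it equals
     [3/2 * a_0] up to the factor [Ci]. *)
  - rewrite Stilde_0, Cmod_Ci_mult by exact Hxi.
    unfold ext_trunc; rewrite HN, le_ext_0, Cmult_0_r, Cplus_0_r.
    rewrite Cmod_mult, Cmod_R, Rabs_pos_eq by lra; lra.
Qed.

Lemma Stilde_norm_bounds (N : ext_nat) (xi : R) (a : nat -> C) : 0 < xi -> ex_series (V_term N a) ->
  ex_series (S_term N (Stilde N xi a)) /\
  normV N a <= 6 * normS N (Stilde N xi a) /\ normS N (Stilde N xi a) <= 4 * normV N a.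
Proof.
  intros Hxi Ha; apply perturbed_series_bounds; [apply V_term_pos|apply S_term_pos| | | | |exact Ha].
  1, 2: intros s; pose proof (Stilde_perturbation N xi a (S s) Hxi ltac:(lia)) as H;
    apply Rabs_le_between in H; lra.
  - now apply S_term_0_bound.
  - now apply V_term_0_bound.
Qed.

(** * Linearity, injectivity and surjectivity *)

Lemma Stilde_minus (N : ext_nat) (xi : R) (a b : nat -> C) (s : nat) : 0 < xi ->
  Stilde N xi (fun k => a k - b k)%C s = (Stilde N xi a s - Stilde N xi b s)%C.
Proof.
  intros Hxi.
  assert (Ht : forall k, ext_trunc N (fun k => a k - b k)%C k = (ext_trunc N a k - ext_trunc N b k)%C).
  { intros k; unfold ext_trunc; destruct (le_ext k N); [reflexivity|ring]. }
  destruct s as [|s].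
  - rewrite !Stilde_0, !Ht by exact Hxi; ring.
  - rewrite !Stilde_S by (exact Hxi || lia); unfold ground_transform.
    assert (H : forall n, sum_n (fun k => ext_trunc N (fun k => a k - b k)%C k * RtoC (ground_overlap (S s) k))%C n
       = (sum_n (fun k => ext_trunc N a k * RtoC (ground_overlap (S s) k)) n
         - sum_n (fun k => ext_trunc N b k * RtoC (ground_overlap (S s) k)) n)%C :> C).
    { induction n as [|n IH]; [rewrite !sum_O, Ht; ring|].
      rewrite !sum_Sn, IH, Ht; unfold plus; simpl; ring. }
    rewrite H; ring.
Qed.

(** The difference sequence has zero data, so the lower norm bound forces its norm, and then each of
    its terms, to vanish. *)
Lemma Stilde_injective (N : ext_nat) (xi : R) (a b : nat -> C) : 0 < xi ->
  ex_series (V_term N a) -> ex_series (V_term N b) ->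
  (forall s, le_ext s N = true -> Stilde N xi a s = Stilde N xi b s) ->
  forall k, le_ext k N = true -> a k = b k.
Proof.
  intros Hxi Ha Hb Hab k Hk.
  set (d := fun k => (a k - b k)%C).
  assert (Hd : ex_series (V_term N d)).
  { apply (ex_series_le (V := R_CompleteNormedModule)) with (b := fun k => V_term N a k + V_term N b k);
      [|now apply (ex_series_plus (V := R_NormedModule))].
    intros s; unfold norm; simpl; unfold abs; simpl; rewrite Rabs_pos_eq by apply V_term_pos.
    unfold V_term; destruct (le_ext s N); [|lra].
    rewrite <- Rdiv_plus_distr; apply Rmult_le_compat_r.
    - left; apply Rinv_0_lt_compat, sqrt_fact_pos.
    - rewrite <- (Cmod_opp (b s)); apply Cmod_triangle. }
  destruct (Stilde_norm_bounds N xi d Hxi Hd) as [_ [H _]].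
  assert (H0 : normS N (Stilde N xi d) = 0).
  (* Writing zero as [0 * 0] lets a factor [0] be taken out of the series. *)
  { unfold normS; rewrite (Series_ext _ (fun _ => 0 * 0)); [rewrite Series_scal_l; ring|].
    rewrite Rmult_0_l.
    intros s; unfold S_term; destruct (le_ext s N) eqn:Hs; [|reflexivity].
    unfold d; rewrite Stilde_minus, Hab by assumption.
    replace (Stilde N xi b s - Stilde N xi b s)%C with (RtoC 0) by ring.
    rewrite Cmod_0; unfold Rdiv; ring. }
  pose proof (term_le_Series _ k (V_term_pos N d) Hd) as Hle.
  fold (normV N d) in Hle.
  unfold V_term in Hle; rewrite Hk in Hle.
  assert (Hz : Cmod (d k) = 0).
  { pose proof (sqrt_fact_pos k) as Hf.
    apply Rle_antisym; [|apply Cmod_ge_0].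
    assert (Hdiv : Cmod (d k) / sqrt (INR (fact k)) <= 0) by lra.
    apply Rle_div_l in Hdiv; lra. }
  apply Cmod_eq_0 in Hz; unfold d in Hz.
  replace (a k) with (a k - b k + b k)%C by ring; rewrite Hz; ring.
Qed.

Lemma ground_transform_ext (a b : nat -> C) (s : nat) :
  (forall k, (k <= s)%nat -> a k = b k) -> ground_transform a s = ground_transform b s.
Proof.
  intros H; apply sum_n_ext_loc; intros k Hk; now rewrite H.
Qed.

(** Forward substitution in a triangular system with nonzero diagonal. The entry [a 0] stays a free
    parameter, to be fixed later by the exceptional row [0] of the data. *)
Lemma ground_transform_surjective (t : nat -> C) (c : C) (n : nat) :
  exists a : nat -> C, a 0%nat = c /\
    forall s, (1 <= s <= n)%nat -> ground_transform a s = t s.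
Proof.
  induction n as [|n [a [Ha0 Ha]]]; [exists (fun _ => c); split; [reflexivity|lia]|].
  pose (x := ((t (S n) - ground_tail a (S n)) * RtoC (sqrt (2 ^ S n)))%C).
  pose (a' := fun k => if (k =? S n)%nat then x else a k).
  assert (Ha' : forall k, (k <= n)%nat -> a' k = a k).
  { intros k Hk; unfold a'; destruct (Nat.eqb_spec k (S n)); [lia|reflexivity]. }
  exists a'; split; [rewrite Ha' by lia; exact Ha0|].
  intros s Hs; destruct (Nat.eq_dec s (S n)) as [->|Hne].
  - rewrite ground_transform_diag.
    assert (H1 : a' (S n) = x) by (unfold a'; now rewrite Nat.eqb_refl).
    assert (H2 : ground_tail a' (S n) = ground_tail a (S n)).
    { apply sum_n_ext_loc; intros k Hk; now rewrite Ha'. }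
    assert (H3 : (RtoC (sqrt (2 ^ S n)) * RtoC (/ sqrt (2 ^ S n)))%C = 1).
    { rewrite <- RtoC_mult, Rinv_r; [reflexivity|].
      apply Rgt_not_eq, sqrt_lt_R0, pow_lt; lra. }
    rewrite H1, H2; unfold x; rewrite <- Cmult_assoc, H3; ring.
  - rewrite (ground_transform_ext a' a) by (intros k Hk; apply Ha'; lia).
    apply Ha; lia.
Qed.

Lemma Ci_sqr : (Ci * Ci)%C = (- RtoC 1)%C.
Proof. unfold Ci, Cmult, Copp, RtoC; simpl; f_equal; ring. Qed.

Lemma Stilde_surjective (n : nat) (xi : R) (t : nat -> C) : (1 <= n)%nat -> 0 < xi ->
  exists a : nat -> C, forall s, (s <= n)%nat -> Stilde (Fin n) xi a s = t s.
Proof.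
  intros Hn Hxi.
  (* The value of [a 0] solves [t_0 - sqrt 2 * t_2 = 2 i a_0] if row [2] is present, and
     [t_0 = 3/2 i a_0] if [n = 1]; [- Ci] is the inverse of [Ci]. *)
  pose (c := if (2 <=? n)%nat then (- Ci * RtoC (/ 2) * (t 0%nat - RtoC (sqrt 2) * t 2%nat))%C
             else (- Ci * RtoC (2 / 3) * t 0%nat)%C).
  destruct (ground_transform_surjective (fun s => - Ci * t s)%C c n) as [a [Ha0 Ha]].
  exists a.
  assert (Hpos : forall s, (1 <= s <= n)%nat -> Stilde (Fin n) xi a s = t s).
  { intros s Hs; rewrite Stilde_S by (exact Hxi || lia).
    rewrite (ground_transform_ext _ a).
    - rewrite Ha by exact Hs.
      transitivity (- (Ci * Ci) * t s)%C; [ring|rewrite Ci_sqr; ring].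
    - intros k Hk; unfold ext_trunc; simpl.
      destruct (Nat.leb_spec k n); [reflexivity|lia]. }
  intros s Hs; destruct s as [|s]; [|apply Hpos; lia].
  unfold c in Ha0; destruct (Nat.leb_spec 2 n) as [H2|H2].
  - rewrite Stilde_0_2, Hpos, Ha0 by (exact Hxi || lia).
    transitivity (RtoC (sqrt 2) * t 2%nat - (Ci * Ci) * (RtoC 2 * RtoC (/ 2)) * (t 0%nat - RtoC (sqrt 2) * t 2%nat))%C; [ring|].
    rewrite Ci_sqr, <- RtoC_mult, Rinv_r by lra; ring.
  - rewrite Stilde_0 by exact Hxi; unfold ext_trunc; rewrite le_ext_0.
    simpl; destruct n as [|[|n]]; [lia| |lia]; simpl; rewrite Ha0.
    transitivity (- (Ci * Ci) * (RtoC (3 / 2) * RtoC (2 / 3)) * t 0%nat)%C; [ring|].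
    rewrite Ci_sqr, <- RtoC_mult.
    replace (3 / 2 * (2 / 3)) with 1 by field; ring.
Qed.

Theorem mainTheorem2 :
  (* injectivity of L^lin(xi) *)
  (forall (N : ext_nat) (xi : R), valid_ext N -> admissible_xi xi ->
     forall a b : nat -> C,
       ex_series (V_term N a) -> ex_series (V_term N b) ->
       (forall s : nat, le_ext s N = true -> Stilde N xi a s = Stilde N xi b s) ->
       forall k : nat, le_ext k N = true -> a k = b k) /\
  (* hence bijectivity onto C^{n+1} for finite n *)
  (forall (n : nat) (xi : R), (1 <= n)%nat -> admissible_xi xi ->
     forall t : nat -> C, exists a : nat -> C,
       forall s : nat, (s <= n)%nat -> Stilde (Fin n) xi a s = t s) /\
  (* two-sided norm estimate with constants independent of xi and n *)
  (exists C1 C2 : R, 0 < C1 /\ 0 < C2 /\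
     forall (N : ext_nat) (xi : R) (a : nat -> C),
       valid_ext N -> admissible_xi xi -> ex_series (V_term N a) ->
       ex_series (S_term N (Stilde N xi a)) /\
       C1 * normV N a <= normS N (Stilde N xi a) /\
       normS N (Stilde N xi a) <= C2 * normV N a).
Proof.
  split; [|split].
  - intros N xi _ [Hxi _] a b; now apply Stilde_injective.
  - intros n xi Hn [Hxi _] t; now apply Stilde_surjective.
  - exists (/ 6), 4; split; [lra|split; [lra|]].
    intros N xi a _ [Hxi _] Ha.
    destruct (Stilde_norm_bounds N xi a Hxi Ha) as [H1 [H2 H3]].
    split; [exact H1|split; [lra|exact H3]].
Qed.
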